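(* Let $X$ be a real or complex Banach space and let $U:\Delta_{+}\to\mathcal{B}(X)$ be an evolution operator. If $U$ has a strong exponential dichotomy with the dichotomy projection $P:\mathbb{R}_{+}\to\mathcal{B}(X)$ (with $Q(t)=Id-P(t)$), then there exist $K\geq 1$, $\delta\geq 0$ and $\gamma>0$ such that for each $H\in\mathcal{H}_{\gamma}(P)$ there is a Lyapunov function $L:\mathbb{R}_{+}\times X\to\mathbb{R}$ corresponding to $U$, $P(\cdot)$ and $H(\cdot)$ which satisfies, for all $(t,x)\in\mathbb{R}_{+}\times X$: $(L_1)$ $L(t,P(t)x)\geq 0$ and $L(t,Q(t)x)\leq 0$; $(L_2)$ $e^{-2\gamma t}L(t,P(t)x)-e^{2\gamma t}L(t,Q(t)x)\leq Ke^{2\delta t}\|x\|^{2}$.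
   Context: Let $X$ be a real or complex Banach space, $\mathcal{B}(X)$ the Banach algebra of bounded linear operators on $X$, and $\Delta_{+}=\{(t,s)\in\mathbb{R}_{+}\times\mathbb{R}_{+}: t\geq s\}$, where $\mathbb{R}_+=[0,\infty)$. Evolution operator: a map $U:\Delta_{+}\to\mathcal{B}(X)$ with $U(t,t)=Id$ for all $t\ge 0$; $U(t,s)U(s,t_0)=U(t,t_0)$ for all $t\geq s\geq t_0\ge 0$; and $(t,s)\mapsto U(t,s)x$ continuous on $\Delta_{+}$ for every $x\in X$. Projection valued function: a strongly continuous map $P:\mathbb{R}_{+}\to\mathcal{B}(X)$ with $P(t)^2=P(t)$ for all $t$; write $Q(t)=Id-P(t)$, so $\operatorname{Ker}P(t)=\operatorname{Range}Q(t)$. Compatibility: $P(\cdot)$ is compatible with $U$ if $P(t)U(t,s)=U(t,s)P(s)$ for all $(t,s)\in\Delta_{+}$ and the restriction $U(t,s)|_{\operatorname{Ker}P(s)}:\operatorname{Ker}P(s)\to\operatorname{Ker}P(t)$ is an isomorphism for each $(t,s)\in\Delta_{+}$; its inverse is denoted $V(s,t):\operatorname{Ker}P(t)\to\operatorname{Ker}P(s)$. Strong exponential dichotomy: $U$ has a strong exponential dichotomy if there are a projection valued function $P$ compatible with $U$ and constants $N\geq1$, $\alpha\geq0$, $\beta>0$ with $\|U(t,s)P(s)\|\leq Ne^{\alpha s}e^{-\beta(t-s)}$ and $\|V(s,t)Q(t)\|\leq Ne^{\alpha s}e^{-\beta(t-s)}$ for all $(t,s)\in\Delta_{+}$; such a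 $P(\cdot)$ is called the dichotomy projection. For $\gamma>0$, $\mathcal{H}_{\gamma}(P)$ is the set of all strongly continuous maps $H:\mathbb{R}_{+}\to\mathcal{B}(X)$ with $\|H(t)x\|\leq e^{\gamma t}\|P(t)x\|+e^{-\gamma t}\|Q(t)x\|$ for all $(t,x)\in\mathbb{R}_{+}\times X$. Lyapunov function: given $U$, a compatible $P(\cdot)$ and $H\in\mathcal{H}_{\gamma}(P)$, a continuous function $L:\mathbb{R}_{+}\times X\to\mathbb{R}$ is a Lyapunov function corresponding to $U$, $P(\cdot)$ and $H(\cdot)$ if $L(t,U(t,s)x)+\int_{s}^{t}\|H(\tau)U(\tau,s)x\|^{2}d\tau\leq L(s,x)$ for all $(t,s)\in\Delta_{+}$ and $x\in X$. *)

(* Defs.v *)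
From Stdlib Require Export Reals.
From Coquelicot Require Export Coquelicot.

Set Implicit Arguments.
Unset Strict Implicit.
Open Scope R_scope.

(* Time-dependent objects are total functions on [R] (or [R * R]); all
   conditions below are imposed only for nonnegative times, resp. on
   [Delta_plus], and continuity is relative to these sets. *)

Definition R_plus (t : R) : Prop := 0 <= t.

Definition Delta_plus (p : R * R) : Prop := 0 <= snd p /\ snd p <= fst p.

Definition continuous_within {S T : UniformSpace} (D : S -> Prop) (f : S -> T)
  : Prop :=
  forall p, D p -> filterlim f (within D (locally p)) (locally (f p)).

Section Operators.

Context {F : AbsRing} {X : NormedModule F}.

(* [is_linear] is linearity together with boundedness. *)
Record bounded_operator : Type := BoundedOperator {
  op_fun :> X -> X;
  op_linear : is_linear op_fun
}.

(* Defined on arbitrary maps, so that it applies directly to compositions. *)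
Definition op_norm (T : X -> X) : Rbar :=
  Lub_Rbar (fun r => exists x, norm x <= 1 /\ r = norm (T x)).

(* [W] restricted to [B] is the bounded inverse of [T] restricted to [A].  When
   [T] is linear and [A], [B] are subspaces, [W] is automatically linear on
   [B]. *)
Record inverse_between (A B : X -> Prop) (T W : X -> X) : Prop := {
  ib_maps : forall x, A x -> B (T x);
  ib_inv_maps : forall y, B y -> A (W y);
  ib_left : forall x, A x -> W (T x) = x;
  ib_right : forall y, B y -> T (W y) = y;
  ib_bounded : exists M : R, forall y, B y -> norm (W y) <= M * norm y
}.

Definition isomorphism_between (A B : X -> Prop) (T : X -> X) : Prop :=
  exists W : X -> X, inverse_between A B T W.

Definition strongly_continuous (P : R -> bounded_operator) : Prop :=
  forall x : X, continuous_within R_plus (fun t : R => P t x).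

Record evolution_operator (U : R -> R -> bounded_operator) : Prop := {
  evol_id : forall t x, 0 <= t -> U t t x = x;
  evol_comp : forall t s t0 x, 0 <= t0 -> t0 <= s -> s <= t ->
    U t s (U s t0 x) = U t t0 x;
  evol_continuous : forall x : X,
    continuous_within Delta_plus (fun p : R * R => U (fst p) (snd p) x)
}.

Record projection_valued (P : R -> bounded_operator) : Prop := {
  proj_continuous : strongly_continuous P;
  proj_idem : forall t x, 0 <= t -> P t (P t x) = P t x
}.

Definition compl (P : R -> bounded_operator) (t : R) (x : X) : X :=
  minus x (P t x).

Definition Ker (T : X -> X) (x : X) : Prop := T x = zero.

Record compatible (U : R -> R -> bounded_operator) (P : R -> bounded_operator)
  : Prop := {
  compat_commute : forall t s x, Delta_plus (t, s) ->
    P t (U t s x) = U t s (P s x);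
  compat_iso : forall t s, Delta_plus (t, s) ->
    isomorphism_between (Ker (P s)) (Ker (P t)) (U t s)
}.

(* The values of [V s t] outside [Ker (P t)] are irrelevant; on [Ker (P t)] they
   are determined by [inverse_between]. *)
Definition kernel_inverse (U : R -> R -> bounded_operator)
    (P : R -> bounded_operator) (V : R -> R -> X -> X) : Prop :=
  forall t s, Delta_plus (t, s) ->
    inverse_between (Ker (P s)) (Ker (P t)) (U t s) (V s t).

Definition strong_exponential_dichotomy (U : R -> R -> bounded_operator)
    (P : R -> bounded_operator) : Prop :=
  projection_valued P /\ compatible U P /\
  exists (V : R -> R -> X -> X) (N alpha beta : R),
    kernel_inverse U P V /\
    1 <= N /\ 0 <= alpha /\ 0 < beta /\
    forall t s, Delta_plus (t, s) ->
      Rbar_le (op_norm (fun x => U t s (P s x)))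
        (N * exp (alpha * s) * exp (- beta * (t - s))) /\
      Rbar_le (op_norm (fun x => V s t (compl P t x)))
        (N * exp (alpha * s) * exp (- beta * (t - s))).

Definition H_class (gamma : R) (P H : R -> bounded_operator) : Prop :=
  strongly_continuous H /\
  forall t x, 0 <= t ->
    norm (H t x) <=
      exp (gamma * t) * norm (P t x) + exp (- gamma * t) * norm (compl P t x).

(* The integrand is continuous in [tau] on [[s, t]] when [U] is an evolution
   operator and [H] is strongly continuous, so that [RInt] is the actual
   Riemann integral. *)
Record lyapunov_function (U : R -> R -> bounded_operator)
    (H : R -> bounded_operator) (L : R -> X -> R) : Prop := {
  lyap_continuous :
    continuous_within (fun q : R * X => R_plus (fst q))
      (fun q : R * X => L (fst q) (snd q));
  lyap_decrease : forall t s x, Delta_plus (t, s) ->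
    L t (U t s x) + RInt (fun tau => (norm (H tau (U tau s x))) ^ 2) s t
      <= L s x
}.

End Operators.

Arguments bounded_operator {F} X.

(* Main.v *)
Require Import Defs.
From Stdlib Require Import Reals Lra Classical ClassicalEpsilon.
From Coquelicot Require Import Coquelicot.
Open Scope R_scope.

(** Fix a dichotomy with constants [N], [alpha], [beta], choose [gamma] strictly
    between [0] and [beta], and put

      [L t x = 2 int_t^oo |H(tau) U(tau,t) P(t) x|^2 dtau
               - 2 int_0^t |H(tau) V(tau,t) Q(t) x|^2 dtau].

    Along an orbit [tau |-> U(tau,s) x] the first integral loses exactly its part
    over [[s,t]] and the second one gains exactly its part over [[s,t]], because
    [V(tau,t) U(t,s) = U(tau,s)] on the kernels when [s <= tau <= t].  So [L]
    drops by at least [2 int_s^t (|H U P x|^2 + |H U Q x|^2)], which dominates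
    [int_s^t |H U x|^2] since [|a + b|^2 <= 2 |a|^2 + 2 |b|^2]; this is
    [lyapunov_function_lyapunov], and it is the reason for the factors [2].

    On the range of [P(tau)] the map [H(tau)] grows at most like
    [exp (gamma tau)], on its kernel at most like [exp (- gamma tau)]; as
    [gamma < beta], the dichotomy estimates make the two integrands decay
    exponentially away from [tau = t], at rate [2 (beta - gamma)]
    ([forward_integrand_le], [backward_integrand_le]).  This gives convergence
    and the growth bound, with [delta = alpha] and [K] of the order of
    [N^2 / (beta - gamma)].  The signs hold because the first integral vanishes
    on [Ker P(t)] and the second one on the range of [P(t)].

    Joint continuity of [L] rests on two facts.  A strongly continuous, locally
    bounded family of linear operators is jointly continuous
    ([continuous_within_family]); the dichotomy bounds supply the local bounds,
    for [P], [Q] and [H] as well.  And an integral of a jointly continuous integrand over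
    an interval with continuous endpoints is continuous in the parameter
    ([continuous_within_RInt]).  The delicate point is the strong continuity of
    [V(s,t) Q(t)], proved in [continuous_within_unstable].  The improper
    integral is a locally uniform limit of integrals over bounded intervals. *)

(** * Continuity relative to a set *)

Lemma continuous_within_comp {S T W : UniformSpace} (D : S -> Prop)
    (E : T -> Prop) (f : S -> T) (g : T -> W) :
  continuous_within D f -> (forall p, D p -> E (f p)) ->
  continuous_within E g -> continuous_within D (fun p => g (f p)).
Proof.
  intros Hf HE Hg p Hp A HA.
  specialize (Hf p Hp _ (Hg _ (HE _ Hp) _ HA)).
  revert Hf; unfold filtermap, within.
  apply filter_imp; auto.
Qed.

Lemma continuous_within_pair {S T W : UniformSpace} (D : S -> Prop)
    (f : S -> T) (g : S -> W) :
  continuous_within D f -> continuous_within D g ->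
  continuous_within D (fun p => (f p, g p)).
Proof.
  intros Hf Hg p Hp.
  apply filterlim_locally; intros eps.
  apply filter_and.
  - exact (proj1 (filterlim_locally _ _) (Hf p Hp) eps).
  - exact (proj1 (filterlim_locally _ _) (Hg p Hp) eps).
Qed.

Lemma continuous_within_continuous {S T : UniformSpace} (D : S -> Prop)
    (f : S -> T) :
  (forall p, continuous f p) -> continuous_within D f.
Proof.
  intros Hf p Hp A HA.
  apply filter_le_within, (Hf p A HA).
Qed.

Lemma continuous_within_subset {S T : UniformSpace} (D E : S -> Prop)
    (f : S -> T) :
  (forall p, E p -> D p) -> continuous_within D f -> continuous_within E f.
Proof.
  intros HED Hf p Hp A HA.
  specialize (Hf p (HED p Hp) A HA).
  revert Hf; unfold filtermap, within; apply filter_imp; auto.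
Qed.

Lemma continuous_within_ext {S T : UniformSpace} (D : S -> Prop)
    (f g : S -> T) :
  (forall p, D p -> f p = g p) ->
  continuous_within D f -> continuous_within D g.
Proof.
  intros Heq Hf p Hp; rewrite <- (Heq p Hp).
  exact (filterlim_within_ext _ _ _ Heq (Hf p Hp)).
Qed.

Lemma continuous_within_fst {S T W : UniformSpace} (D : S -> Prop)
    (f : S -> T * W) :
  continuous_within D f -> continuous_within D (fun p => fst (f p)).
Proof.
  intros Hf; apply (continuous_within_comp D (fun _ => True) f fst Hf); auto.
  apply continuous_within_continuous; intros [u v]; apply continuous_fst.
Qed.

Lemma continuous_within_snd {S T W : UniformSpace} (D : S -> Prop)
    (f : S -> T * W) :
  continuous_within D f -> continuous_within D (fun p => snd (f p)).
Proof.
  intros Hf; apply (continuous_within_comp D (fun _ => True) f snd Hf); auto.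
  apply continuous_within_continuous; intros [u v]; apply continuous_snd.
Qed.

Lemma continuous_within_id {S : UniformSpace} (D : S -> Prop) :
  continuous_within D (fun p => p).
Proof.
  apply continuous_within_continuous; intros p; apply continuous_id.
Qed.

Lemma continuous_within_const {S T : UniformSpace} (D : S -> Prop) (c : T) :
  continuous_within D (fun _ => c).
Proof.
  apply continuous_within_continuous; intros p; apply continuous_const.
Qed.

Lemma continuous_within_plus {K : AbsRing} {V : NormedModule K}
    {S : UniformSpace} (D : S -> Prop) (f g : S -> V) :
  continuous_within D f -> continuous_within D g ->
  continuous_within D (fun p => plus (f p) (g p)).
Proof.
  intros Hf Hg p Hp.
  exact (filterlim_comp_2 _ _ plus (Hf p Hp) (Hg p Hp) (filterlim_plus _ _)).
Qed.

Lemma continuous_within_minus {K : AbsRing} {V : NormedModule K}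
    {S : UniformSpace} (D : S -> Prop) (f g : S -> V) :
  continuous_within D f -> continuous_within D g ->
  continuous_within D (fun p => minus (f p) (g p)).
Proof.
  intros Hf Hg; apply continuous_within_plus; [exact Hf|].
  intros p Hp.
  exact (filterlim_comp _ _ _ _ _ _ _ _ (Hg p Hp) (filterlim_opp _)).
Qed.

Lemma continuous_within_Rmult {S : UniformSpace} (D : S -> Prop)
    (f g : S -> R) :
  continuous_within D f -> continuous_within D g ->
  continuous_within D (fun p => f p * g p).
Proof.
  intros Hf Hg p Hp.
  exact (filterlim_comp_2 _ _ Rmult (Hf p Hp) (Hg p Hp) (filterlim_mult _ _)).
Qed.

Lemma continuous_within_Rplus {S : UniformSpace} (D : S -> Prop)
    (f g : S -> R) :
  continuous_within D f -> continuous_within D g ->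
  continuous_within D (fun p => f p + g p).
Proof. exact (continuous_within_plus (V := R_NormedModule) D f g). Qed.

Lemma continuous_within_Rminus {S : UniformSpace} (D : S -> Prop)
    (f g : S -> R) :
  continuous_within D f -> continuous_within D g ->
  continuous_within D (fun p => f p - g p).
Proof. exact (continuous_within_minus (V := R_NormedModule) D f g). Qed.

Lemma continuous_within_sqr_norm {K : AbsRing} {V : NormedModule K}
    {S : UniformSpace} (D : S -> Prop) (f : S -> V) :
  continuous_within D f -> continuous_within D (fun p => norm (f p) ^ 2).
Proof.
  intros Hf.
  assert (Hn : continuous_within D (fun p => norm (f p))).
  { intros p Hp.
    exact (filterlim_comp _ _ _ _ _ _ _ _ (Hf p Hp) (filterlim_norm _)). }
  apply (continuous_within_ext D (fun p => norm (f p) * norm (f p))).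
  - intros p _; exact (Rsqr_pow2 _).
  - apply continuous_within_Rmult; exact Hn.
Qed.

Lemma continuous_within_exp {S : UniformSpace} (D : S -> Prop) (f : S -> R) :
  continuous_within D f -> continuous_within D (fun p => exp (f p)).
Proof.
  intros Hf; apply (continuous_within_comp D (fun _ => True) f exp Hf); auto.
  apply continuous_within_continuous; intros u.
  apply (continuous_comp (fun x => x) exp); [apply continuous_id|].
  apply continuous_exp.
Qed.

(** * Integrals depending on a parameter *)

Lemma continuous_clamp (a b x : R) :
  continuous (fun x => Rmax a (Rmin x b)) x.
Proof.
  apply filterlim_locally; intros eps; exists eps; intros y Hy.
  change (Rabs (y - x) < eps) in Hy.
  change (Rabs (Rmax a (Rmin y b) - Rmax a (Rmin x b)) < eps).
  apply Rabs_def2 in Hy; apply Rabs_def1; unfold Rmax, Rmin;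
    repeat destruct Rle_dec; lra.
Qed.

Lemma ex_RInt_continuous_within (f : R -> R) (a b : R) :
  a <= b -> continuous_within (fun x => a <= x <= b) f -> ex_RInt f a b.
Proof.
  intros Hab Hf.
  apply (ex_RInt_ext (fun x => f (Rmax a (Rmin x b)))).
  - intros x; rewrite Rmin_left, Rmax_right by lra; intros Hx.
    rewrite Rmin_left, Rmax_right by lra; reflexivity.
  - apply (ex_RInt_continuous (V := R_CompleteNormedModule)); intros z _.
    assert (Hc : continuous_within (fun _ : R => True)
                   (fun x => f (Rmax a (Rmin x b)))).
    { apply (continuous_within_comp _ (fun x => a <= x <= b)); [| |exact Hf].
      - apply continuous_within_continuous; intros p; apply continuous_clamp.
      - intros p _; unfold Rmax, Rmin.
        repeat destruct Rle_dec; lra. }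
    intros A HA; specialize (Hc z I A HA); revert Hc.
    unfold filtermap, within; apply filter_imp; auto.
Qed.

(** A tube lemma: compactness of the unit interval makes continuity in the
    parameter uniform in the first variable. *)
Lemma unit_interval_tube {S : UniformSpace} (D : S -> Prop) (g : R * S -> R)
    (p0 : S) (eps : R) :
  continuous_within (fun q => 0 <= fst q <= 1 /\ D (snd q)) g ->
  D p0 -> 0 < eps ->
  exists d : posreal, forall (th : R) (p : S),
    0 <= th <= 1 -> D p -> ball p0 d p -> Rabs (g (th, p) - g (th, p0)) < eps.
Proof.
  intros Hg Hp0 Heps.
  assert (Hloc : forall th : R, exists d : posreal, 0 <= th <= 1 ->
            forall q, 0 <= fst q <= 1 /\ D (snd q) -> ball (th, p0) d q ->
            Rabs (g q - g (th, p0)) < eps / 2).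
  { intros th; destruct (classic (0 <= th <= 1)) as [Hth|Hth].
    - assert (He : 0 < eps / 2) by lra.
      destruct (proj1 (filterlim_locally _ _) (Hg (th, p0) (conj Hth Hp0))
                  (mkposreal _ He)) as [d Hd].
      exists d; intros _ q Hq Hb; exact (Hd q Hb Hq).
    - exists (mkposreal 1 Rlt_0_1); tauto. }
  set (delta := fun th => proj1_sig
                  (constructive_indefinite_description _ (Hloc th))).
  assert (Hdelta : forall th, 0 <= th <= 1 ->
            forall q, 0 <= fst q <= 1 /\ D (snd q) -> ball (th, p0) (delta th) q ->
            Rabs (g q - g (th, p0)) < eps / 2).
  { intros th; exact (proj2_sig
                  (constructive_indefinite_description _ (Hloc th))). }
  destruct (compactness_value_1d 0 1 delta) as [d Hd].
  exists d; intros th p Hth Hp Hb.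
  destruct (NNPP _ (Hd th Hth)) as (th0 & Hth0 & Hclose & Hle).
  assert (H1 : Rabs (g (th, p) - g (th0, p0)) < eps / 2).
  { apply Hdelta; [exact Hth0 | split; assumption |].
    split; [exact Hclose | exact (ball_le _ _ _ Hle _ Hb)]. }
  assert (H2 : Rabs (g (th, p0) - g (th0, p0)) < eps / 2).
  { apply Hdelta; [exact Hth0 | split; assumption |].
    split; [exact Hclose | apply ball_center]. }
  apply Rabs_def2 in H1; apply Rabs_def2 in H2; apply Rabs_def1; lra.
Qed.

Lemma continuous_within_RInt_unit {S : UniformSpace} (D : S -> Prop)
    (g : R * S -> R) :
  continuous_within (fun q => 0 <= fst q <= 1 /\ D (snd q)) g ->
  continuous_within D (fun p => RInt (fun th => g (th, p)) 0 1).
Proof.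
  intros Hg p0 Hp0.
  assert (Hex : forall p, D p -> ex_RInt (fun th => g (th, p)) 0 1).
  { intros p Hp; apply ex_RInt_continuous_within; [lra|].
    apply (continuous_within_comp _ (fun q => 0 <= fst q <= 1 /\ D (snd q))
             (fun th => (th, p)) g); [| |exact Hg].
    - apply continuous_within_pair;
        [apply continuous_within_id | apply continuous_within_const].
    - intros th Hth; split; assumption. }
  apply filterlim_locally; intros eps.
  assert (He : 0 < eps / 2) by (destruct eps; simpl; lra).
  destruct (unit_interval_tube D g p0 (eps / 2) Hg Hp0 He) as [d Hd].
  exists d; intros p Hb Hp.
  change (Rabs (RInt (fun th => g (th, p)) 0 1
                - RInt (fun th => g (th, p0)) 0 1) < eps).
  rewrite <- (RInt_minus (V := R_CompleteNormedModule)) by auto.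
  apply Rle_lt_trans with ((1 - 0) * (eps / 2)); [|lra].
  apply abs_RInt_le_const; [lra| |].
  - apply (ex_RInt_minus (V := R_NormedModule)); auto.
  - intros th Hth; left; exact (Hd th p Hth Hp Hb).
Qed.

(** Rescaling [[a p, b p]] to the unit interval moves the dependence on the
    endpoints into the integrand. *)
Lemma continuous_within_RInt {S : UniformSpace} (D : S -> Prop)
    (a b : S -> R) (f : R * S -> R) :
  continuous_within D a -> continuous_within D b ->
  (forall p, D p -> a p <= b p) ->
  continuous_within
    (fun q => a (snd q) <= fst q <= b (snd q) /\ D (snd q)) f ->
  continuous_within D (fun p => RInt (fun tau => f (tau, p)) (a p) (b p)).
Proof.
  intros Ha Hb Hab Hf.
  set (h := fun q : R * S => (b (snd q) - a (snd q)) * fst q + a (snd q)).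
  apply (continuous_within_ext D (fun p =>
           RInt (fun th => (b p - a p) * f (h (th, p), p)) 0 1)).
  { intros p Hp; unfold h; simpl.
    assert (Hex : ex_RInt (fun tau => f (tau, p)) (a p) (b p)).
    { apply ex_RInt_continuous_within; [auto|].
      eapply (continuous_within_comp _ _ (fun tau => (tau, p)) f);
        [| |exact Hf].
      - apply continuous_within_pair;
          [apply continuous_within_id | apply continuous_within_const].
      - intros tau Htau; split; assumption. }
    replace (RInt (fun tau => f (tau, p)) (a p) (b p)) with
      (RInt (fun tau => f (tau, p)) ((b p - a p) * 0 + a p)
         ((b p - a p) * 1 + a p)) by (f_equal; ring).
    apply (RInt_comp_lin (V := R_CompleteNormedModule)
             (fun tau => f (tau, p))).
    replace ((b p - a p) * 0 + a p) with (a p) by ring.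
    replace ((b p - a p) * 1 + a p) with (b p) by ring.
    exact Hex. }
  apply (continuous_within_RInt_unit D
           (fun q => (b (snd q) - a (snd q)) * f (h q, snd q))).
  assert (Hs : continuous_within
                 (fun q : R * S => 0 <= fst q <= 1 /\ D (snd q)) snd).
  { apply (continuous_within_snd _ (fun q => q)), continuous_within_id. }
  assert (Has := continuous_within_comp _ D _ _ Hs
                   (fun q Hq => proj2 Hq) Ha).
  assert (Hbs := continuous_within_comp _ D _ _ Hs
                   (fun q Hq => proj2 Hq) Hb).
  apply continuous_within_Rmult; [apply continuous_within_Rminus; assumption|].
  eapply (continuous_within_comp _ _ (fun q => (h q, snd q)) f); [| |exact Hf].
  - apply continuous_within_pair; [|exact Hs].
    apply continuous_within_Rplus; [|exact Has].
    apply continuous_within_Rmult; [apply continuous_within_Rminus; assumption|].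
    apply (continuous_within_fst _ (fun q => q)), continuous_within_id.
  - intros [th p] [Hth Hp]; simpl in *; split; [|exact Hp].
    specialize (Hab p Hp); unfold h; simpl; nra.
Qed.

(** * Integrals with exponential bounds *)

(** One statement serves both time directions: [k] is negative for the integral
    towards infinity and positive for the one towards the past. *)
Lemma RInt_le_exp (f : R -> R) (k m C a b : R) :
  k <> 0 -> a <= b -> ex_RInt f a b ->
  (forall x, a <= x <= b -> f x <= C * exp (k * x + m)) ->
  RInt f a b <= C * (exp (k * b + m) - exp (k * a + m)) / k.
Proof.
  intros Hk Hab Hex Hf.
  assert (Hi : is_RInt (fun x => C * exp (k * x + m)) a b
                 (C * (exp (k * b + m) - exp (k * a + m)) / k)).
  { replace (C * (exp (k * b + m) - exp (k * a + m)) / k) with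
      (minus (C / k * exp (k * b + m)) (C / k * exp (k * a + m)))
      by (unfold minus, plus, opp; simpl; field; exact Hk).
    apply (is_RInt_derive (V := R_CompleteNormedModule)
             (fun x => C / k * exp (k * x + m))).
    - intros x _; auto_derive; [trivial | field; exact Hk].
    - intros x _; apply (ex_derive_continuous (V := R_NormedModule)).
      auto_derive; trivial. }
  rewrite <- (is_RInt_unique _ _ _ _ Hi).
  apply RInt_le; [exact Hab | exact Hex | eexists; exact Hi |].
  intros x Hx; apply Hf; lra.
Qed.

(** For a nonnegative integrand this is the improper integral from [a] to
    infinity; as a supremum it can be compared termwise. *)
Definition sup_RInt (f : R -> R) (a : R) : R :=
  real (Lub_Rbar (fun r => exists T, a <= T /\ r = RInt f a T)).

Lemma sup_RInt_finite (f : R -> R) (a M : R) :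
  (forall T, a <= T -> RInt f a T <= M) ->
  is_lub_Rbar (fun r => exists T, a <= T /\ r = RInt f a T) (sup_RInt f a).
Proof.
  intros HM; unfold sup_RInt.
  assert (Hl := Lub_Rbar_correct (fun r => exists T, a <= T /\ r = RInt f a T)).
  destruct (Lub_Rbar _) as [l| |]; [exact Hl | exfalso | exfalso].
  - apply (proj2 Hl (Finite M)); intros r (T & HT & ->); exact (HM T HT).
  - apply (proj1 Hl (RInt f a a)); exists a; split; [lra | reflexivity].
Qed.

Lemma sup_RInt_ub (f : R -> R) (a M T : R) :
  (forall T, a <= T -> RInt f a T <= M) -> a <= T ->
  RInt f a T <= sup_RInt f a.
Proof.
  intros HM HT; apply (proj1 (sup_RInt_finite f a M HM)).
  exists T; auto.
Qed.

Lemma sup_RInt_le (f : R -> R) (a M : R) :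
  (forall T, a <= T -> RInt f a T <= M) -> sup_RInt f a <= M.
Proof.
  intros HM; apply (proj2 (sup_RInt_finite f a M HM) (Finite M)).
  intros r (T & HT & ->); exact (HM T HT).
Qed.

(** The approximant may depend on the point, which is all that locally uniform
    convergence provides. *)
Lemma continuous_within_approx {S : UniformSpace} (D : S -> Prop) (f : S -> R) :
  (forall p0 eps, D p0 -> 0 < eps -> exists g : S -> R,
     continuous_within D g /\
     within D (locally p0) (fun p => Rabs (f p - g p) <= eps)) ->
  continuous_within D f.
Proof.
  intros Happ p0 Hp0; apply filterlim_locally; intros [eps Heps].
  destruct (Happ p0 (eps / 4) Hp0 ltac:(lra)) as (g & Hg & Hfg).
  assert (He : 0 < eps / 4) by lra.
  assert (Hgl := proj1 (filterlim_locally _ _) (Hg p0 Hp0) (mkposreal _ He)).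
  assert (H0 := locally_singleton _ _ Hfg Hp0).
  generalize (filter_and _ _ Hfg Hgl); unfold filtermap, within.
  apply filter_imp; intros p Hfgp Hp; destruct (Hfgp Hp) as [H1 H2].
  change (Rabs (g p - g p0) < eps / 4) in H2.
  change (Rabs (f p - f p0) < eps).
  apply Rabs_def2 in H2; apply Rabs_le_between in H0; apply Rabs_le_between in H1.
  apply Rabs_def1; lra.
Qed.

(** * Families of linear operators *)

(** From [G q x - G q0 x0 = G q (x - x0) + (G q x0 - G q0 x0)]: the local bound
    [m] controls the first term, strong continuity the second. *)
Lemma continuous_within_family {K : AbsRing} {V : NormedModule K}
    {S : UniformSpace} (D : S -> Prop) (G : S -> V -> V) (m : S -> R) :
  (forall q x y, D q -> G q (minus x y) = minus (G q x) (G q y)) ->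
  continuous_within D m ->
  (forall q x, D q -> norm (G q x) <= m q * norm x) ->
  (forall x, continuous_within D (fun q => G q x)) ->
  continuous_within (fun q : S * V => D (fst q)) (fun q => G (fst q) (snd q)).
Proof.
  intros Hlin Hm Hbound Hstrong [q0 x0] Hq0; simpl in Hq0 |- *.
  apply filterlim_locally_ball_norm; intros [eps Heps].
  set (M := Rabs (m q0) + 1).
  assert (HM : 0 < M) by (unfold M; generalize (Rabs_pos (m q0)); lra).
  assert (He2 : 0 < eps / 2) by lra.
  assert (HeM : 0 < eps / 2 / M) by (apply Rdiv_lt_0_compat; lra).
  destruct (proj1 (filterlim_locally_ball_norm _ _) (Hstrong x0 q0 Hq0)
              (mkposreal _ He2)) as [d1 Hd1].
  destruct (proj1 (filterlim_locally _ _) (Hm q0 Hq0) (mkposreal 1 Rlt_0_1))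
    as [d2 Hd2].
  destruct (locally_ball_norm x0 (mkposreal _ HeM)) as [d3 Hd3].
  assert (Hd : 0 < Rmin d1 (Rmin d2 d3)).
  { destruct d1, d2, d3; simpl; repeat apply Rmin_glb_lt; assumption. }
  exists (mkposreal _ Hd); intros [q x] [Hq Hx] HDq; simpl in *.
  assert (Hq1 : ball q0 d1 q) by (eapply ball_le; [apply Rmin_l | exact Hq]).
  assert (Hq2 : ball q0 d2 q).
  { eapply ball_le; [|exact Hq].
    eapply Rle_trans; [apply Rmin_r | apply Rmin_l]. }
  assert (Hx3 : ball x0 d3 x).
  { eapply ball_le; [|exact Hx].
    eapply Rle_trans; [apply Rmin_r | apply Rmin_r]. }
  specialize (Hd1 q Hq1 HDq); specialize (Hd2 q Hq2 HDq); specialize (Hd3 x Hx3).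
  unfold ball_norm in *; simpl in *.
  change (Rabs (m q - m q0) < 1) in Hd2.
  assert (HmM : m q <= M).
  { unfold M; apply Rabs_def2 in Hd2; generalize (Rle_abs (m q0)); lra. }
  rewrite (minus_trans (G q x0) (G q x) (G q0 x0)), <- Hlin by exact HDq.
  eapply Rle_lt_trans; [apply norm_triangle|].
  assert (H1 : norm (G q (minus x x0)) <= M * norm (minus x x0)).
  { eapply Rle_trans; [apply Hbound; exact HDq|].
    apply Rmult_le_compat_r; [apply norm_ge_0 | exact HmM]. }
  assert (H2 : M * norm (minus x x0) < eps / 2).
  { apply (Rmult_lt_compat_l M) in Hd3; [|exact HM].
    replace (M * (eps / 2 / M)) with (eps / 2) in Hd3 by (field; lra).
    exact Hd3. }
  lra.
Qed.

Lemma minus_plus_plus {G : AbelianGroup} (a b c d : G) :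
  minus (plus a b) (plus c d) = plus (minus a c) (minus b d).
Proof.
  unfold minus; rewrite opp_plus, <- !plus_assoc; f_equal.
  rewrite !plus_assoc; f_equal; apply plus_comm.
Qed.

Lemma minus_plus {G : AbelianGroup} (a b : G) : plus (minus a b) b = a.
Proof.
  unfold minus; rewrite <- plus_assoc, plus_opp_l; apply plus_zero_r.
Qed.

Lemma additive_minus {K : AbsRing} {V : NormedModule K} (T : V -> V) :
  (forall x y, T (plus x y) = plus (T x) (T y)) ->
  (forall k x, T (scal k x) = scal k (T x)) ->
  forall x y, T (minus x y) = minus (T x) (T y).
Proof.
  intros Hplus Hscal x y; unfold minus.
  rewrite Hplus; f_equal.
  transitivity (T (scal (opp one) y)).
  - f_equal; symmetry; apply (scal_opp_one (V := V)).
  - rewrite Hscal; apply (scal_opp_one (V := V)).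
Qed.

(** The operator norm is a supremum over the unit ball, so the estimate for general
    [x] needs a scalar of modulus [norm x]; this is where the scalars have to be
    real or complex. *)
Lemma op_norm_bound {F : AbsRing} (hF : F = R_AbsRing \/ F = C_AbsRing)
    {X : NormedModule F} (T : X -> X) (M : R) :
  (forall k x, T (scal k x) = scal k (T x)) ->
  Rbar_le (op_norm T) M -> forall x, norm (T x) <= M * norm x.
Proof.
  intros Hscal HM x.
  assert (Hunit : forall y, norm y <= 1 -> norm (T y) <= M).
  { intros y Hy.
    apply (Rbar_le_trans (norm (T y)) (op_norm T) M); [|exact HM].
    apply (proj1 (Lub_Rbar_correct _)); exists y; auto. }
  destruct (Req_dec (norm x) 0) as [H0|H0].
  - assert (Hx : x = scal zero x).
    { rewrite scal_zero_l; exact (norm_eq_zero x H0). }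
    rewrite H0, Hx, Hscal, scal_zero_l, Rmult_0_r.
    right; apply norm_zero.
  - assert (Hr : 0 < norm x) by (generalize (norm_ge_0 x); lra).
    assert (Hk : exists k l : F, mult k l = one /\ abs k <= norm x
                                 /\ abs l <= / norm x).
    { clear - hF Hr; revert Hr; generalize (norm x) as r; intros r Hr.
      destruct hF as [-> | ->].
      - exists r, (/ r); split; [|split].
        + apply Rinv_r; lra.
        + change (Rabs r <= r); rewrite Rabs_pos_eq; lra.
        + change (Rabs (/ r) <= / r); rewrite Rabs_pos_eq; [lra|].
          left; apply Rinv_0_lt_compat, Hr.
      - exists (RtoC r), (RtoC (/ r)); split; [|split].
        + change (RtoC r * RtoC (/ r) = 1)%C.
          rewrite <- RtoC_mult; f_equal; apply Rinv_r; lra.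
        + change (Cmod r <= r); rewrite Cmod_R, Rabs_pos_eq; lra.
        + change (Cmod (/ r)%R <= / r); rewrite Cmod_R, Rabs_pos_eq; [lra|].
          left; apply Rinv_0_lt_compat, Hr. }
    destruct Hk as (k & l & Hkl & Hk & Hl).
    rewrite <- (scal_one x) at 1; rewrite <- Hkl, <- scal_assoc, Hscal.
    eapply Rle_trans; [apply norm_scal|].
    rewrite Rmult_comm; apply Rmult_le_compat;
      [apply norm_ge_0 | apply abs_ge_0 | | exact Hk].
    apply Hunit; eapply Rle_trans; [apply norm_scal|].
    apply Rle_trans with (/ norm x * norm x).
    + apply Rmult_le_compat_r; [lra | exact Hl].
    + right; apply Rinv_l; exact H0.
Qed.

(** * Evolution operators with a dichotomy *)

Section Dichotomy.

Context {F : AbsRing} {X : NormedModule F}.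
Context (U : R -> R -> bounded_operator X) (P : R -> bounded_operator X)
  (V : R -> R -> X -> X) (N alpha beta : R).
Context (hU : evolution_operator U) (hP : projection_valued P)
  (hUP : compatible U P) (hV : kernel_inverse U P V)
  (halpha : 0 <= alpha).

Lemma op_minus (T : bounded_operator X) (x y : X) :
  T (minus x y) = minus (T x) (T y).
Proof.
  apply additive_minus; [apply (linear_plus _ (op_linear T))
                        | apply (linear_scal _ (op_linear T))].
Qed.

Lemma op_zero (T : bounded_operator X) : T zero = zero.
Proof.
  transitivity (T (minus zero zero)).
  - f_equal; symmetry; apply (minus_eq_zero (G := X)).
  - rewrite op_minus; apply (minus_eq_zero (G := X)).
Qed.

Lemma compl_plus t x y :
  compl P t (plus x y) = plus (compl P t x) (compl P t y).
Proof.
  unfold compl; rewrite (linear_plus _ (op_linear (P t))).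
  apply (minus_plus_plus (G := X)).
Qed.

Lemma compl_scal t k x : compl P t (scal k x) = scal k (compl P t x).
Proof.
  unfold compl; rewrite (linear_scal _ (op_linear (P t))).
  symmetry; apply (scal_minus_distr_l (V := X)).
Qed.

Lemma continuous_within_apply (T : R -> bounded_operator X) (m : R -> R) :
  strongly_continuous T -> continuous_within R_plus m ->
  (forall t x, 0 <= t -> norm (T t x) <= m t * norm x) ->
  forall (S : UniformSpace) (D : S -> Prop) (r : S -> R) (y : S -> X),
  continuous_within D r -> continuous_within D y -> (forall p, D p -> 0 <= r p) ->
  continuous_within D (fun p => T (r p) (y p)).
Proof.
  intros HT Hm Hbound S D r y Hr Hy Hpos.
  apply (continuous_within_comp D (fun q : R * X => R_plus (fst q))
           (fun p => (r p, y p)) (fun q => T (fst q) (snd q))).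
  - apply continuous_within_pair; assumption.
  - exact Hpos.
  - apply (continuous_within_family R_plus (fun t => T t) m);
      [intros t u v _; apply op_minus | assumption..].
Qed.

Lemma proj_compl t x : 0 <= t -> P t (compl P t x) = zero.
Proof.
  intros Ht; unfold compl; rewrite op_minus, (proj_idem hP) by exact Ht.
  apply (minus_eq_zero (G := X)).
Qed.

Lemma compl_proj t x : 0 <= t -> compl P t (P t x) = zero.
Proof.
  intros Ht; unfold compl; rewrite (proj_idem hP) by exact Ht.
  apply (minus_eq_zero (G := X)).
Qed.

Lemma compl_ker t x : P t x = zero -> compl P t x = x.
Proof. intros Hx; unfold compl; rewrite Hx; apply (minus_zero_r (G := X)). Qed.

Lemma proj_plus_compl t x : plus (P t x) (compl P t x) = x.
Proof.
  rewrite plus_comm; apply (minus_plus (G := X)).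
Qed.

Lemma ker_plus t x y : P t x = zero -> P t y = zero -> P t (plus x y) = zero.
Proof.
  intros Hx Hy; rewrite (linear_plus _ (op_linear (P t))), Hx, Hy.
  apply (plus_zero_l (G := X)).
Qed.

Lemma ker_scal t k x : P t x = zero -> P t (scal k x) = zero.
Proof.
  intros Hx; rewrite (linear_scal _ (op_linear (P t))), Hx; apply (scal_zero_r (V := X)).
Qed.

Lemma compl_evol t s x : 0 <= s <= t ->
  compl P t (U t s x) = U t s (compl P s x).
Proof.
  intros [Hs Hst]; unfold compl.
  rewrite op_minus, (compat_commute hUP) by (split; assumption); reflexivity.
Qed.

(** Linearity is inherited from [U t s], which [V s t] inverts on the kernels. *)
Lemma kernel_inverse_linear t s : 0 <= s <= t ->
  (forall x y, V s t (compl P t (plus x y))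
               = plus (V s t (compl P t x)) (V s t (compl P t y))) /\
  (forall k x, V s t (compl P t (scal k x)) = scal k (V s t (compl P t x))).
Proof.
  intros [Hs Hst].
  destruct (hV t s (conj Hs Hst)) as [_ Hker Hleft Hright _].
  assert (HQ : forall x, Ker (P t) (compl P t x)).
  { intros x; apply proj_compl; lra. }
  split.
  - intros x y; rewrite compl_plus.
    rewrite <- (Hright _ (HQ x)) at 1; rewrite <- (Hright _ (HQ y)) at 1.
    rewrite <- (linear_plus _ (op_linear (U t s))).
    apply Hleft, ker_plus; apply Hker, HQ.
  - intros k x; rewrite compl_scal.
    rewrite <- (Hright _ (HQ x)) at 1.
    rewrite <- (linear_scal _ (op_linear (U t s))).
    apply Hleft, ker_scal; apply Hker, HQ.
Qed.

Lemma kernel_inverse_minus t s x y : 0 <= s <= t ->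
  V s t (compl P t (minus x y))
  = minus (V s t (compl P t x)) (V s t (compl P t y)).
Proof.
  intros Hst; destruct (kernel_inverse_linear t s Hst) as [Hplus Hscal].
  exact (additive_minus (fun x => V s t (compl P t x)) Hplus Hscal x y).
Qed.

Lemma kernel_inverse_ker t s x : 0 <= s <= t ->
  P s (V s t (compl P t x)) = zero.
Proof.
  intros [Hs Hst]; apply (ib_inv_maps (hV t s (conj Hs Hst))).
  apply proj_compl; lra.
Qed.

Lemma kernel_inverse_evol t s x : 0 <= s <= t ->
  V s t (compl P t (U t s x)) = compl P s x.
Proof.
  intros [Hs Hst]; rewrite compl_evol by lra.
  apply (ib_left (hV t s (conj Hs Hst))), proj_compl; exact Hs.
Qed.

(** The part of a kernel orbit before time [s] is the same whether it is
    reconstructed from its value at [s] or from its value at a later time. *)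
Lemma kernel_inverse_evol_before t s r x : 0 <= r <= s -> s <= t ->
  V r t (compl P t (U t s x)) = V r s (compl P s x).
Proof.
  intros [Hr Hrs] Hst.
  assert (Hker : P s (compl P s x) = zero) by (apply proj_compl; lra).
  rewrite compl_evol by lra.
  rewrite <- (ib_right (hV s r (conj Hr Hrs)) Hker) at 1.
  rewrite (evol_comp hU) by lra.
  apply (ib_left (hV t r (conj Hr (Rle_trans _ _ _ Hrs Hst)))).
  apply kernel_inverse_ker; lra.
Qed.

Lemma kernel_inverse_evol_after t s r x : 0 <= s <= r -> r <= t ->
  V r t (compl P t (U t s x)) = U r s (compl P s x).
Proof.
  intros [Hs Hsr] Hrt.
  rewrite <- (evol_comp hU (t := t) (s := r) (t0 := s)) by lra.
  rewrite kernel_inverse_evol by lra; apply compl_evol; lra.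
Qed.

Context
  (hstable : forall t s x, 0 <= s <= t ->
     norm (U t s (P s x)) <= N * exp (alpha * s) * exp (- beta * (t - s)) * norm x)
  (hunstable : forall t s x, 0 <= s <= t ->
     norm (V s t (compl P t x))
       <= N * exp (alpha * s) * exp (- beta * (t - s)) * norm x).

(** The stable estimate on the diagonal [t = s] bounds [P] itself. *)
Lemma norm_proj t x : 0 <= t -> norm (P t x) <= N * exp (alpha * t) * norm x.
Proof.
  intros Ht; assert (H := hstable t t x (conj Ht (Rle_refl t))).
  rewrite (evol_id hU) in H by exact Ht.
  replace (- beta * (t - t)) with 0 in H by ring.
  rewrite exp_0, Rmult_1_r in H; exact H.
Qed.

(** On the diagonal [V t t] is the identity of [Ker (P t)], so the unstable
    estimate there bounds the complementary projection. *)
Lemma norm_compl t x : 0 <= t ->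
  norm (compl P t x) <= N * exp (alpha * t) * norm x.
Proof.
  intros Ht; assert (H := hunstable t t x (conj Ht (Rle_refl t))).
  rewrite <- (evol_id hU (t := t) x Ht), kernel_inverse_evol in H by lra.
  rewrite (evol_id hU) in H by exact Ht.
  replace (- beta * (t - t)) with 0 in H by ring.
  rewrite exp_0, Rmult_1_r in H; exact H.
Qed.

Ltac solve_continuous :=
  repeat lazymatch goal with
    | |- continuous_within _ (fun p => exp (@?f p)) =>
        apply (continuous_within_exp _ f)
    | |- continuous_within _ (fun p => @?f p - @?g p) =>
        apply (continuous_within_Rminus _ f g)
    | |- continuous_within _ (fun p => @?f p + @?g p) =>
        apply (continuous_within_Rplus _ f g)
    | |- continuous_within _ (fun p => @?f p * @?g p) =>
        apply (continuous_within_Rmult _ f g)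
    | |- continuous_within _ (fun p => fst (@?f p)) =>
        apply (continuous_within_fst _ f)
    | |- continuous_within _ (fun p => snd (@?f p)) =>
        apply (continuous_within_snd _ f)
    | |- continuous_within _ fst => apply (continuous_within_fst _ (fun p => p))
    | |- continuous_within _ snd => apply (continuous_within_snd _ (fun p => p))
    | |- continuous_within _ (fun p => p) => apply continuous_within_id
    | |- continuous_within _ (fun _ => ?c) => apply continuous_within_const
    end.

Lemma continuous_within_proj {S : UniformSpace} (D : S -> Prop)
    (r : S -> R) (y : S -> X) :
  continuous_within D r -> continuous_within D y -> (forall p, D p -> 0 <= r p) ->
  continuous_within D (fun p => P (r p) (y p)).
Proof.
  apply (continuous_within_apply P (fun t => N * exp (alpha * t))).
  - exact (proj_continuous hP).
  - solve_continuous.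
  - exact norm_proj.
Qed.

(** Strong continuity comes from rewriting [U(t,s) P(s) x] as [P(t) U(t,s) x], a
    jointly continuous map applied to a continuous one. *)
Lemma continuous_within_stable :
  continuous_within (fun q : (R * R) * X => Delta_plus (fst q))
    (fun q => U (fst (fst q)) (snd (fst q)) (P (snd (fst q)) (snd q))).
Proof.
  apply (continuous_within_family Delta_plus
           (fun p x => U (fst p) (snd p) (P (snd p) x))
           (fun p => N * exp (alpha * snd p) * exp (- beta * (fst p - snd p)))).
  - intros p x y _; rewrite !op_minus; reflexivity.
  - solve_continuous.
  - intros [t s] x Hp; exact (hstable t s x Hp).
  - intros x.
    apply (continuous_within_ext _ (fun p => P (fst p) (U (fst p) (snd p) x))).
    + intros [t s] Hp; apply (compat_commute hUP); exact Hp.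
    + apply continuous_within_proj; [solve_continuous | apply (evol_continuous hU)|].
      intros p Hp; exact (Rle_trans _ _ _ (proj1 Hp) (proj2 Hp)).
Qed.

(** Strong continuity of [(t, s) |-> V(s,t) Q(t) x] at [(t0, s0)] is the
    point.  With [y = V(s0,t0) Q(t0) x] one has [V(s,t) Q(t) U(t,s) y = Q(s) y], hence

      [V(s,t) Q(t) x = V(s,t) Q(t) (Q(t) x - U(t,s) y) + Q(s) y].

    The argument [Q(t) x - U(t,s) y] is continuous and vanishes at [(t0, s0)],
    because [U(t0,s0) y = Q(t0) x]; so the first term tends to [0] by the local
    bound, and [Q(s) y] tends to [Q(s0) y = y]. *)
Lemma continuous_within_unstable :
  continuous_within (fun q : (R * R) * X => Delta_plus (fst q))
    (fun q => V (snd (fst q)) (fst (fst q)) (compl P (fst (fst q)) (snd q))).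
Proof.
  apply (continuous_within_family Delta_plus
           (fun p x => V (snd p) (fst p) (compl P (fst p) x))
           (fun p => N * exp (alpha * snd p) * exp (- beta * (fst p - snd p)))).
  - intros [t s] x y Hp; exact (kernel_inverse_minus t s x y Hp).
  - solve_continuous.
  - intros [t s] x Hp; exact (hunstable t s x Hp).
  - intros x [t0 s0] Hp0; simpl.
    set (y := V s0 t0 (compl P t0 x)).
    assert (HUy : U t0 s0 y = compl P t0 x).
    { apply (ib_right (hV t0 s0 Hp0)), proj_compl; destruct Hp0; simpl in *; lra. }
    assert (HQy : compl P s0 y = y).
    { apply compl_ker, kernel_inverse_ker; exact Hp0. }
    assert (Hcompl : forall (r : R * R -> R) z,
      continuous_within Delta_plus r -> (forall p, Delta_plus p -> 0 <= r p) ->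
      continuous_within Delta_plus (fun p => compl P (r p) z)).
    { intros r z Hr Hpos; unfold compl.
      apply continuous_within_minus; [apply continuous_within_const|].
      apply continuous_within_proj; [exact Hr | apply continuous_within_const|].
      exact Hpos. }
    assert (Hpos1 : forall p, Delta_plus p -> 0 <= fst p)
      by (intros p [H1 H2]; lra).
    assert (Hpos2 : forall p, Delta_plus p -> 0 <= snd p)
      by (intros p [H1 H2]; lra).
    assert (Hfst : continuous_within Delta_plus (fst (A := R) (B := R)))
      by (apply (continuous_within_fst _ (fun p => p)), continuous_within_id).
    assert (Hsnd : continuous_within Delta_plus (snd (A := R) (B := R)))
      by (apply (continuous_within_snd _ (fun p => p)), continuous_within_id).
    set (E := fun p : R * R =>
                minus (compl P (fst p) x) (U (fst p) (snd p) y) : X).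
    assert (H1 : continuous_within Delta_plus E).
    { apply continuous_within_minus; [auto | apply (evol_continuous hU)]. }
    assert (H2 := Hcompl snd y Hsnd Hpos2).
    assert (HE0 : norm (E (t0, s0)) = 0).
    { unfold E; simpl; rewrite HUy.
      transitivity (norm (zero : X)); [f_equal; apply (minus_eq_zero (G := X))|].
      apply norm_zero. }
    assert (H3 : continuous_within Delta_plus (fun p =>
       N * exp (alpha * snd p) * exp (- beta * (fst p - snd p)) * norm (E p))).
    { apply continuous_within_Rmult; [solve_continuous|].
      intros p Hp.
      exact (filterlim_comp _ _ _ _ _ _ _ _ (H1 p Hp) (filterlim_norm _)). }
    assert (H4 : filterlim (fun p => V (snd p) (fst p) (compl P (fst p) (E p)))
                   (within Delta_plus (locally (t0, s0))) (locally (zero : X))).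
    { apply filterlim_locally_ball_norm; intros eps.
      generalize (proj1 (filterlim_locally _ _) (H3 _ Hp0) eps).
      unfold filtermap, within; apply filter_imp; intros [t s] Hball Hp.
      specialize (Hball Hp); simpl in Hball, Hp |- *.
      unfold ball_norm.
      apply Rle_lt_trans with (norm (V s t (compl P t (E (t, s)))));
        [right; f_equal; apply (minus_zero_r (G := X))|].
      eapply Rle_lt_trans; [exact (hunstable t s _ Hp)|].
      set (m := N * exp (alpha * s) * exp (- beta * (t - s)) * norm (E (t, s)))
        in *.
      change (Rabs (m - N * exp (alpha * s0) * exp (- beta * (t0 - s0))
                        * norm (E (t0, s0))) < eps) in Hball.
      rewrite HE0, Rmult_0_r in Hball; apply Rabs_def2 in Hball; lra. }
    assert (H5 := filterlim_comp_2 _ _ plus H4 (H2 _ Hp0) (filterlim_plus _ _)).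
    simpl in H5; rewrite HQy in H5.
    assert (Hy : plus zero y = y) by apply (plus_zero_l (G := X)).
    rewrite Hy in H5.
    revert H5; apply filterlim_within_ext; intros [t s] Hp; simpl.
    unfold E; simpl; rewrite (kernel_inverse_minus t s) by exact Hp.
    assert (HQx : compl P t (compl P t x) = compl P t x).
    { apply compl_ker, proj_compl; destruct Hp; simpl in *; lra. }
    rewrite HQx, kernel_inverse_evol by exact Hp.
    apply (minus_plus (G := X)).
Qed.

(** * The forward and backward integrals *)

Context (gamma : R) (hgamma : 0 < gamma < beta)
  (H : R -> bounded_operator X) (hH : H_class gamma P H).

Lemma norm_H_range t x : 0 <= t ->
  norm (H t (P t x)) <= exp (gamma * t) * norm (P t x).
Proof.
  intros Ht; eapply Rle_trans; [apply (proj2 hH t (P t x) Ht)|].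
  rewrite (proj_idem hP), compl_proj by exact Ht.
  assert (Hz := norm_zero (V := X)).
  right; transitivity (exp (gamma * t) * norm (P t x) + exp (- gamma * t) * 0);
    [do 2 f_equal; exact Hz | ring].
Qed.

Lemma norm_H_ker t x : 0 <= t -> P t x = zero ->
  norm (H t x) <= exp (- gamma * t) * norm x.
Proof.
  intros Ht Hx; eapply Rle_trans; [apply (proj2 hH t x Ht)|].
  rewrite (compl_ker t x Hx), Hx.
  assert (Hz := norm_zero (V := X)).
  right; transitivity (exp (gamma * t) * 0 + exp (- gamma * t) * norm x);
    [do 2 f_equal; exact Hz | ring].
Qed.

Lemma norm_H t x : 0 <= t ->
  norm (H t x) <=
    (exp (gamma * t) + exp (- gamma * t)) * (N * exp (alpha * t)) * norm x.
Proof.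
  intros Ht; eapply Rle_trans; [apply (proj2 hH t x Ht)|].
  rewrite !Rmult_assoc, Rmult_plus_distr_r, <- !(Rmult_assoc N).
  apply Rplus_le_compat; apply Rmult_le_compat_l;
    try (left; apply exp_pos); [apply norm_proj | apply norm_compl]; exact Ht.
Qed.

Lemma continuous_within_H {S : UniformSpace} (D : S -> Prop)
    (r : S -> R) (y : S -> X) :
  continuous_within D r -> continuous_within D y -> (forall p, D p -> 0 <= r p) ->
  continuous_within D (fun p => H (r p) (y p)).
Proof.
  apply (continuous_within_apply H (fun t =>
           (exp (gamma * t) + exp (- gamma * t)) * (N * exp (alpha * t)))).
  - exact (proj1 hH).
  - solve_continuous.
  - exact norm_H.
Qed.

Definition forward_integrand (tau t : R) (x : X) : R :=
  norm (H tau (U tau t (P t x))) ^ 2.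

Definition backward_integrand (tau t : R) (x : X) : R :=
  norm (H tau (V tau t (compl P t x))) ^ 2.

Definition forward (t : R) (x : X) : R :=
  sup_RInt (fun tau => forward_integrand tau t x) t.

Definition backward (t : R) (x : X) : R :=
  RInt (fun tau => backward_integrand tau t x) 0 t.

Lemma forward_integrand_ge_0 tau t x : 0 <= forward_integrand tau t x.
Proof. apply pow2_ge_0. Qed.

Lemma backward_integrand_ge_0 tau t x : 0 <= backward_integrand tau t x.
Proof. apply pow2_ge_0. Qed.

Lemma continuous_within_forward_integrand :
  continuous_within (fun q : R * (R * X) => 0 <= fst (snd q) <= fst q)
    (fun q => forward_integrand (fst q) (fst (snd q)) (snd (snd q))).
Proof.
  apply (continuous_within_sqr_norm (V := X)), continuous_within_H.
  - solve_continuous.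
  - apply (continuous_within_comp _ (fun q : (R * R) * X => Delta_plus (fst q))
             (fun q : R * (R * X) => ((fst q, fst (snd q)), snd (snd q)))
             (fun q => U (fst (fst q)) (snd (fst q)) (P (snd (fst q)) (snd q)))).
    + repeat apply continuous_within_pair; solve_continuous.
    + intros q Hq; exact Hq.
    + exact continuous_within_stable.
  - intros q Hq; exact (Rle_trans _ _ _ (proj1 Hq) (proj2 Hq)).
Qed.

Lemma continuous_within_backward_integrand :
  continuous_within
    (fun q : R * (R * X) => 0 <= fst q <= fst (snd q))
    (fun q => backward_integrand (fst q) (fst (snd q)) (snd (snd q))).
Proof.
  apply (continuous_within_sqr_norm (V := X)), continuous_within_H.
  - solve_continuous.
  - apply (continuous_within_comp _ (fun q : (R * R) * X => Delta_plus (fst q))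
             (fun q : R * (R * X) => ((fst (snd q), fst q), snd (snd q)))
             (fun q => V (snd (fst q)) (fst (fst q))
                         (compl P (fst (fst q)) (snd q)))).
    + repeat apply continuous_within_pair; solve_continuous.
    + intros q Hq; exact Hq.
    + exact continuous_within_unstable.
  - intros q Hq; exact (proj1 Hq).
Qed.

Lemma ex_RInt_forward t x a b : 0 <= t -> t <= a <= b ->
  ex_RInt (fun tau => forward_integrand tau t x) a b.
Proof.
  intros Ht Hab; apply ex_RInt_continuous_within; [lra|].
  apply (continuous_within_comp _
           (fun q : R * (R * X) => 0 <= fst (snd q) <= fst q)
           (fun tau => (tau, (t, x)))
           (fun q => forward_integrand (fst q) (fst (snd q)) (snd (snd q))));
    [| |exact continuous_within_forward_integrand].
  - apply continuous_within_pair; solve_continuous.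
  - intros tau Htau; simpl; lra.
Qed.

Lemma ex_RInt_backward t x a b : 0 <= a <= b -> b <= t ->
  ex_RInt (fun tau => backward_integrand tau t x) a b.
Proof.
  intros Hab Hb; apply ex_RInt_continuous_within; [lra|].
  apply (continuous_within_comp _
           (fun q : R * (R * X) => 0 <= fst q <= fst (snd q))
           (fun tau => (tau, (t, x)))
           (fun q => backward_integrand (fst q) (fst (snd q)) (snd (snd q))));
    [| |exact continuous_within_backward_integrand].
  - apply continuous_within_pair; solve_continuous.
  - intros tau Htau; simpl; lra.
Qed.

(** [U(tau,t) P(t) x] lies in the range of [P(tau)], where [H(tau)] costs only
    [exp (gamma tau)]; writing [tau = t + (tau - t)] splits this cost between
    the growth factor in [t] and the decay in [tau - t]. *)
Lemma forward_integrand_le tau t x : 0 <= t <= tau ->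
  forward_integrand tau t x <=
    N ^ 2 * exp (2 * (alpha + gamma) * t) * norm x ^ 2
      * exp (- (2 * (beta - gamma)) * tau + 2 * (beta - gamma) * t).
Proof.
  intros Ht; unfold forward_integrand.
  apply Rle_trans with
    ((exp (gamma * tau)
      * (N * exp (alpha * t) * exp (- beta * (tau - t)) * norm x)) ^ 2).
  - apply pow_incr; split; [apply norm_ge_0|].
    assert (Hrange : P tau (U tau t (P t x)) = U tau t (P t x)).
    { rewrite (compat_commute hUP) by exact Ht.
      rewrite (proj_idem hP) by lra; reflexivity. }
    rewrite <- Hrange; eapply Rle_trans; [apply norm_H_range; lra|].
    rewrite Hrange; apply Rmult_le_compat_l; [left; apply exp_pos|].
    apply hstable; exact Ht.
  - right.
    replace (exp (gamma * tau)
      * (N * exp (alpha * t) * exp (- beta * (tau - t)) * norm x))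
      with (N * norm x * (exp (gamma * tau) * exp (alpha * t)
                          * exp (- beta * (tau - t)))) by ring.
    rewrite <- !exp_plus.
    transitivity (N ^ 2 * norm x ^ 2
      * (exp (2 * (alpha + gamma) * t)
         * exp (- (2 * (beta - gamma)) * tau + 2 * (beta - gamma) * t)));
      [|ring].
    rewrite <- exp_plus, Rpow_mult_distr, Rpow_mult_distr; f_equal.
    simpl; rewrite Rmult_1_r, <- exp_plus; f_equal; ring.
Qed.

(** The weight [exp (alpha tau)] is taken at the earlier time [tau], so it is at
    most [exp (alpha t)]; the cost [exp (- gamma tau)] of [H(tau)] equals
    [exp (- gamma t)] times a growth in [t - tau] that the decay absorbs. *)
Lemma backward_integrand_le tau t x : 0 <= tau <= t ->
  backward_integrand tau t x <=
    N ^ 2 * exp (2 * (alpha - gamma) * t) * norm x ^ 2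
      * exp (2 * (beta - gamma) * tau + - (2 * (beta - gamma) * t)).
Proof.
  intros Ht; unfold backward_integrand.
  apply Rle_trans with
    ((exp (- gamma * tau)
      * (N * exp (alpha * tau) * exp (- beta * (t - tau)) * norm x)) ^ 2).
  - apply pow_incr; split; [apply norm_ge_0|].
    eapply Rle_trans; [apply norm_H_ker; [lra|]|].
    + apply kernel_inverse_ker; exact Ht.
    + apply Rmult_le_compat_l; [left; apply exp_pos|].
      apply hunstable; exact Ht.
  - replace (exp (- gamma * tau)
      * (N * exp (alpha * tau) * exp (- beta * (t - tau)) * norm x))
      with (N * norm x * (exp (- gamma * tau) * exp (alpha * tau)
                          * exp (- beta * (t - tau)))) by ring.
    rewrite <- !exp_plus.
    apply Rle_trans with (N ^ 2 * norm x ^ 2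
      * (exp (2 * (alpha - gamma) * t)
         * exp (2 * (beta - gamma) * tau + - (2 * (beta - gamma) * t))));
      [|right; ring].
    rewrite <- exp_plus, Rpow_mult_distr, Rpow_mult_distr.
    apply Rmult_le_compat_l.
    { apply Rmult_le_pos; apply pow2_ge_0. }
    simpl; rewrite Rmult_1_r, <- exp_plus.
    apply Rnot_lt_le; intros Hlt; apply exp_lt_inv in Hlt.
    assert (0 <= alpha * (t - tau)) by (apply Rmult_le_pos; lra).
    lra.
Qed.

Definition forward_bound (t : R) (x : X) : R :=
  N ^ 2 / (2 * (beta - gamma)) * exp (2 * (alpha + gamma) * t) * norm x ^ 2.

Definition backward_bound (t : R) (x : X) : R :=
  N ^ 2 / (2 * (beta - gamma)) * exp (2 * (alpha - gamma) * t) * norm x ^ 2.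

Lemma forward_bound_ge_0 t x : 0 <= forward_bound t x.
Proof.
  unfold forward_bound; apply Rmult_le_pos; [|apply pow2_ge_0].
  apply Rmult_le_pos; [|left; apply exp_pos].
  apply Rmult_le_pos; [apply pow2_ge_0|].
  left; apply Rinv_0_lt_compat; lra.
Qed.

Lemma RInt_forward_le t x a b : 0 <= t -> t <= a <= b ->
  RInt (fun tau => forward_integrand tau t x) a b
    <= forward_bound t x * exp (- (2 * (beta - gamma)) * (a - t)).
Proof.
  intros Ht Hab.
  eapply Rle_trans.
  - apply (RInt_le_exp _ (- (2 * (beta - gamma))) (2 * (beta - gamma) * t)
             (N ^ 2 * exp (2 * (alpha + gamma) * t) * norm x ^ 2));
      [lra | lra | apply ex_RInt_forward; assumption |].
    intros tau Htau; apply forward_integrand_le; lra.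
  - replace (- (2 * (beta - gamma)) * (a - t)) with
      (- (2 * (beta - gamma)) * a + 2 * (beta - gamma) * t) by ring.
    assert (Hb := exp_pos (- (2 * (beta - gamma)) * b + 2 * (beta - gamma) * t)).
    assert (H0 := forward_bound_ge_0 t x).
    match goal with |- ?l <= _ => replace l with (forward_bound t x
      * (exp (- (2 * (beta - gamma)) * a + 2 * (beta - gamma) * t)
         - exp (- (2 * (beta - gamma)) * b + 2 * (beta - gamma) * t)))
      by (unfold forward_bound; field; lra) end.
    apply Rmult_le_compat_l; [exact H0 | lra].
Qed.

Lemma backward_le t x : 0 <= t -> backward t x <= backward_bound t x.
Proof.
  intros Ht; unfold backward; eapply Rle_trans.
  - apply (RInt_le_exp _ (2 * (beta - gamma)) (- (2 * (beta - gamma) * t))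
             (N ^ 2 * exp (2 * (alpha - gamma) * t) * norm x ^ 2));
      [lra | lra | apply ex_RInt_backward; lra |].
    intros tau Htau; apply backward_integrand_le; lra.
  - replace (2 * (beta - gamma) * t + - (2 * (beta - gamma) * t)) with 0 by ring.
    rewrite exp_0.
    assert (H0 := exp_pos (2 * (beta - gamma) * 0 + - (2 * (beta - gamma) * t))).
    match goal with |- ?l <= _ => replace l with (backward_bound t x
      * (1 - exp (2 * (beta - gamma) * 0 + - (2 * (beta - gamma) * t))))
      by (unfold backward_bound; field; lra) end.
    rewrite <- (Rmult_1_r (backward_bound t x)) at 2.
    apply Rmult_le_compat_l; [|lra].
    unfold backward_bound; apply Rmult_le_pos; [|apply pow2_ge_0].
    apply Rmult_le_pos; [|left; apply exp_pos].
    apply Rmult_le_pos; [apply pow2_ge_0|].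
    left; apply Rinv_0_lt_compat; lra.
Qed.

Lemma backward_ge_0 t x : 0 <= t -> 0 <= backward t x.
Proof.
  intros Ht; apply RInt_ge_0; [exact Ht | apply ex_RInt_backward; lra |].
  intros tau _; apply backward_integrand_ge_0.
Qed.

Lemma RInt_forward_bounded t x T : 0 <= t -> t <= T ->
  RInt (fun tau => forward_integrand tau t x) t T <= forward_bound t x.
Proof.
  intros Ht HT; eapply Rle_trans; [apply RInt_forward_le; lra|].
  replace (- (2 * (beta - gamma)) * (t - t)) with 0 by ring.
  rewrite exp_0; lra.
Qed.

Lemma RInt_le_forward t x T : 0 <= t -> t <= T ->
  RInt (fun tau => forward_integrand tau t x) t T <= forward t x.
Proof.
  intros Ht HT; apply (sup_RInt_ub _ _ (forward_bound t x)); [|exact HT].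
  intros; apply RInt_forward_bounded; assumption.
Qed.

Lemma forward_le t x : 0 <= t -> forward t x <= forward_bound t x.
Proof.
  intros Ht; apply sup_RInt_le; intros; apply RInt_forward_bounded; assumption.
Qed.

Lemma forward_ge_0 t x : 0 <= t -> 0 <= forward t x.
Proof.
  (* The integral over the degenerate interval is a competitor in the supremum. *)
  intros Ht; eapply Rle_trans; [|apply (RInt_le_forward t x t); lra].
  right; symmetry; apply (RInt_point (V := R_CompleteNormedModule)).
Qed.

Lemma RInt_forward_Chasles t x a b : 0 <= t -> t <= a <= b ->
  RInt (fun tau => forward_integrand tau t x) t b
  = RInt (fun tau => forward_integrand tau t x) t a
    + RInt (fun tau => forward_integrand tau t x) a b.
Proof.
  intros Ht Hab; symmetry.
  apply (RInt_Chasles (V := R_CompleteNormedModule));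
    apply ex_RInt_forward; lra.
Qed.

(** The truncation error, uniform for [(t, x)] in bounded sets when [a - t] is
    fixed. *)
Lemma forward_tail t x a : 0 <= t -> t <= a ->
  forward t x <= RInt (fun tau => forward_integrand tau t x) t a
                 + forward_bound t x * exp (- (2 * (beta - gamma)) * (a - t)).
Proof.
  intros Ht Ha; apply sup_RInt_le; intros T HT.
  assert (Hexp := exp_pos (- (2 * (beta - gamma)) * (a - t))).
  assert (H0 := forward_bound_ge_0 t x).
  destruct (Rle_dec T a) as [HTa|HTa].
  - rewrite (RInt_forward_Chasles t x T a) by lra.
    assert (0 <= RInt (fun tau => forward_integrand tau t x) T a).
    { apply RInt_ge_0; [exact HTa | apply ex_RInt_forward; lra |].
      intros; apply forward_integrand_ge_0. }
    nra.
  - rewrite (RInt_forward_Chasles t x a T) by lra.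
    apply Rplus_le_compat_l, RInt_forward_le; lra.
Qed.

Lemma continuous_within_backward :
  continuous_within (fun q : R * X => R_plus (fst q))
    (fun q => backward (fst q) (snd q)).
Proof.
  apply (continuous_within_RInt (fun q : R * X => R_plus (fst q))
           (fun _ => 0) fst
           (fun q => backward_integrand (fst q) (fst (snd q)) (snd (snd q)))).
  - solve_continuous.
  - apply (continuous_within_fst _ (fun q => q)), continuous_within_id.
  - auto.
  - eapply continuous_within_subset;
      [|exact continuous_within_backward_integrand].
    intros q [Hq _]; exact Hq.
Qed.

Lemma continuous_within_forward :
  continuous_within (fun q : R * X => R_plus (fst q))
    (fun q => forward (fst q) (snd q)).
Proof.
  apply continuous_within_approx; intros p0 eps Hp0 Heps.
  set (c := 2 * (beta - gamma)).
  assert (Hc : 0 < c) by (unfold c; lra).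
  set (B := forward_bound (fst p0) (snd p0) + 1).
  assert (HB : 0 < B).
  { unfold B; generalize (forward_bound_ge_0 (fst p0) (snd p0)); lra. }
  (* Chosen so that [1 + c n] already exceeds [B / eps], hence so does
     [exp (c n)]. *)
  set (n := B / eps / c).
  assert (Hn : 0 < n).
  { repeat apply Rdiv_lt_0_compat; assumption. }
  assert (Hsmall : B * exp (- c * n) <= eps).
  { replace (- c * n) with (- (c * n)) by ring; rewrite exp_Ropp.
    assert (Hcn : B / eps <= exp (c * n)).
    { eapply Rle_trans; [|apply exp_ineq1_le].
      replace (c * n) with (B / eps) by (unfold n; field; lra); lra. }
    assert (Hpos := exp_pos (c * n)).
    apply (Rmult_le_reg_r (exp (c * n))); [exact Hpos|].
    rewrite Rmult_assoc, Rinv_l, Rmult_1_r by lra.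
    apply (Rmult_le_compat_l eps) in Hcn; [|lra].
    replace (eps * (B / eps)) with B in Hcn by (field; lra); exact Hcn. }
  exists (fun p => RInt (fun tau => forward_integrand tau (fst p) (snd p))
                     (fst p) (fst p + n)).
  split.
  - apply (continuous_within_RInt (fun q : R * X => R_plus (fst q))
             fst (fun q => fst q + n)
             (fun q => forward_integrand (fst q) (fst (snd q)) (snd (snd q)))).
    + apply (continuous_within_fst _ (fun q => q)), continuous_within_id.
    + solve_continuous.
    + intros; lra.
    + eapply continuous_within_subset;
        [|exact continuous_within_forward_integrand].
      intros q [[Hq _] Hpos]; split; [exact Hpos | exact Hq].
  - assert (Hbound : continuous_within (fun q : R * X => R_plus (fst q))
                       (fun q => forward_bound (fst q) (snd q))).
    { unfold forward_bound; apply continuous_within_Rmult.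
      - solve_continuous.
      - apply (continuous_within_sqr_norm (V := X)); solve_continuous. }
    generalize (proj1 (filterlim_locally _ _) (Hbound p0 Hp0)
                  (mkposreal 1 Rlt_0_1)).
    unfold filtermap, within; apply filter_imp; intros [t x] Hball Ht.
    specialize (Hball Ht); simpl in Ht, Hball |- *.
    change (Rabs (forward_bound t x - forward_bound (fst p0) (snd p0)) < 1)
      in Hball.
    apply Rabs_def2 in Hball.
    assert (H1 := RInt_le_forward t x (t + n) Ht ltac:(lra)).
    assert (H2 := forward_tail t x (t + n) Ht ltac:(lra)).
    replace (- (2 * (beta - gamma)) * (t + n - t)) with (- c * n) in H2
      by (unfold c; ring).
    assert (H3 : forward_bound t x * exp (- c * n) <= B * exp (- c * n)).
    { apply Rmult_le_compat_r; [left; apply exp_pos | unfold B; lra]. }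
    apply Rabs_le; lra.
Qed.

(** * The Lyapunov function *)

Lemma sqr_norm_plus_le (x y : X) :
  norm (plus x y) ^ 2 <= 2 * norm x ^ 2 + 2 * norm y ^ 2.
Proof.
  apply Rle_trans with ((norm x + norm y) ^ 2).
  - apply pow_incr; split; [apply norm_ge_0 | apply norm_triangle].
  - generalize (pow2_ge_0 (norm x - norm y)); nra.
Qed.

(** For [tau >= t] the integrand of [forward t (U t s x)] is that of
    [forward s x], so each integral over [[s, T]] splits at [t]. *)
Lemma forward_evol t s x : 0 <= s <= t ->
  RInt (fun tau => forward_integrand tau s x) s t + forward t (U t s x)
    <= forward s x.
Proof.
  intros Hst.
  enough (forward t (U t s x)
          <= forward s x - RInt (fun tau => forward_integrand tau s x) s t)
    by lra.
  apply sup_RInt_le; intros T HT.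
  rewrite (RInt_ext _ (fun tau => forward_integrand tau s x)).
  - assert (H1 := RInt_le_forward s x T ltac:(lra) ltac:(lra)).
    rewrite (RInt_forward_Chasles s x t T) in H1 by lra.
    lra.
  - intros tau; rewrite Rmin_left, Rmax_right by lra; intros Htau.
    unfold forward_integrand.
    rewrite (compat_commute hUP) by (split; simpl; lra).
    rewrite (evol_comp hU) by lra; reflexivity.
Qed.

Lemma backward_evol t s x : 0 <= s <= t ->
  backward t (U t s x)
  = backward s x + RInt (fun tau => backward_integrand tau t (U t s x)) s t.
Proof.
  intros Hst; unfold backward.
  rewrite <- (RInt_Chasles (V := R_CompleteNormedModule) _ 0 s t)
    by (apply ex_RInt_backward; lra).
  apply (f_equal2 Rplus); [|reflexivity].
  apply RInt_ext; intros tau; rewrite Rmin_left, Rmax_right by lra.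
  intros Htau; unfold backward_integrand.
  rewrite kernel_inverse_evol_before by lra; reflexivity.
Qed.

(** On [[s, t]] the integrand defining [backward t (U t s x)] is
    [|H(tau) U(tau,s) Q(s) x|^2]. *)
Lemma RInt_evol_le t s x : 0 <= s <= t ->
  RInt (fun tau => norm (H tau (U tau s x)) ^ 2) s t <=
    2 * RInt (fun tau => forward_integrand tau s x) s t
    + 2 * RInt (fun tau => backward_integrand tau t (U t s x)) s t.
Proof.
  intros Hst.
  assert (Hf : ex_RInt (fun tau => forward_integrand tau s x) s t)
    by (apply ex_RInt_forward; lra).
  assert (Hb : ex_RInt (fun tau => backward_integrand tau t (U t s x)) s t)
    by (apply ex_RInt_backward; lra).
  assert (Hi : is_RInt (fun tau => 2 * forward_integrand tau s x
                          + 2 * backward_integrand tau t (U t s x)) s t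
                 (2 * RInt (fun tau => forward_integrand tau s x) s t
    + 2 * RInt (fun tau => backward_integrand tau t (U t s x)) s t)).
  { apply (is_RInt_plus (V := R_NormedModule));
      apply (is_RInt_scal (V := R_NormedModule));
      apply (RInt_correct (V := R_CompleteNormedModule)); assumption. }
  rewrite <- (is_RInt_unique _ _ _ _ Hi).
  apply RInt_le; [lra | | eexists; exact Hi |].
  - apply ex_RInt_continuous_within; [lra|].
    apply (continuous_within_sqr_norm (V := X)), continuous_within_H.
    + solve_continuous.
    + apply (continuous_within_comp _ Delta_plus (fun tau => (tau, s))
               (fun p => U (fst p) (snd p) x)).
      * apply continuous_within_pair; solve_continuous.
      * intros tau Htau; split; simpl; lra.
      * apply (evol_continuous hU).
    + intros tau Htau; lra.
  - intros tau Htau; unfold forward_integrand, backward_integrand.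
    rewrite kernel_inverse_evol_after by lra.
    rewrite <- (proj_plus_compl s x) at 1.
    rewrite (linear_plus _ (op_linear (U tau s))).
    rewrite (linear_plus _ (op_linear (H tau))).
    apply sqr_norm_plus_le.
Qed.

Definition lyapunov (t : R) (x : X) : R := 2 * forward t x - 2 * backward t x.

Lemma lyapunov_function_lyapunov : lyapunov_function U H lyapunov.
Proof.
  split.
  - apply continuous_within_Rminus; apply continuous_within_Rmult;
      try apply continuous_within_const;
      [exact continuous_within_forward | exact continuous_within_backward].
  - intros t s x Hst; unfold lyapunov.
    assert (H1 := forward_evol t s x Hst).
    assert (H2 := backward_evol t s x Hst).
    assert (H3 := RInt_evol_le t s x Hst).
    lra.
Qed.

Lemma forward_zero t : 0 <= t -> forward t zero = 0.
Proof.
  intros Ht; apply Rle_antisym; [|apply forward_ge_0, Ht].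
  eapply Rle_trans; [apply forward_le, Ht|]; unfold forward_bound.
  assert (Hz := norm_zero (V := X)); rewrite Hz; lra.
Qed.

Lemma backward_zero t : 0 <= t -> backward t zero = 0.
Proof.
  intros Ht; apply Rle_antisym; [|apply backward_ge_0, Ht].
  eapply Rle_trans; [apply backward_le, Ht|]; unfold backward_bound.
  assert (Hz := norm_zero (V := X)); rewrite Hz; lra.
Qed.

Lemma lyapunov_range t x : 0 <= t -> lyapunov t (P t x) = 2 * forward t x.
Proof.
  intros Ht; unfold lyapunov.
  replace (forward t (P t x)) with (forward t x).
  2:{ unfold forward, forward_integrand; rewrite (proj_idem hP) by exact Ht.
      reflexivity. }
  replace (backward t (P t x)) with (backward t zero).
  2:{ unfold backward, backward_integrand; rewrite (compl_proj t x Ht).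
      rewrite (compl_ker t zero (op_zero (P t))); reflexivity. }
  rewrite backward_zero by exact Ht; ring.
Qed.

Lemma lyapunov_ker t x : 0 <= t -> lyapunov t (compl P t x) = - 2 * backward t x.
Proof.
  intros Ht; unfold lyapunov.
  assert (HPQ := proj_compl t x Ht).
  replace (forward t (compl P t x)) with (forward t zero).
  2:{ unfold forward, forward_integrand; rewrite HPQ, (op_zero (P t)).
      reflexivity. }
  replace (backward t (compl P t x)) with (backward t x).
  2:{ unfold backward, backward_integrand; rewrite (compl_ker t _ HPQ).
      reflexivity. }
  rewrite forward_zero by exact Ht; ring.
Qed.

Lemma lyapunov_sign t x : 0 <= t ->
  0 <= lyapunov t (P t x) /\ lyapunov t (compl P t x) <= 0.
Proof.
  intros Ht; rewrite lyapunov_range, lyapunov_ker by exact Ht.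
  generalize (forward_ge_0 t x Ht) (backward_ge_0 t x Ht); lra.
Qed.

(** The weights [exp (- 2 gamma t)] and [exp (2 gamma t)] cancel the factors
    [exp (2 gamma t)] and [exp (- 2 gamma t)] of [forward_bound] and
    [backward_bound], so both halves contribute the same amount. *)
Lemma lyapunov_bound t x : 0 <= t ->
  exp (- 2 * gamma * t) * lyapunov t (P t x)
    - exp (2 * gamma * t) * lyapunov t (compl P t x)
  <= 2 * N ^ 2 / (beta - gamma) * exp (2 * alpha * t) * norm x ^ 2.
Proof.
  intros Ht; rewrite lyapunov_range, lyapunov_ker by exact Ht.
  assert (H1 := Rmult_le_compat_l (exp (- 2 * gamma * t)) _ _
                  (Rlt_le _ _ (exp_pos _)) (forward_le t x Ht)).
  assert (H2 := Rmult_le_compat_l (exp (2 * gamma * t)) _ _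
                  (Rlt_le _ _ (exp_pos _)) (backward_le t x Ht)).
  assert (E1 : exp (- 2 * gamma * t) * forward_bound t x =
    N ^ 2 / (2 * (beta - gamma)) * exp (2 * alpha * t) * norm x ^ 2).
  { unfold forward_bound.
    replace (2 * alpha * t) with
      (- 2 * gamma * t + 2 * (alpha + gamma) * t) by ring.
    rewrite exp_plus; ring. }
  assert (E2 : exp (2 * gamma * t) * backward_bound t x =
    N ^ 2 / (2 * (beta - gamma)) * exp (2 * alpha * t) * norm x ^ 2).
  { unfold backward_bound.
    replace (2 * alpha * t) with
      (2 * gamma * t + 2 * (alpha - gamma) * t) by ring.
    rewrite exp_plus; ring. }
  assert (E3 : 2 * N ^ 2 / (beta - gamma) * exp (2 * alpha * t) * norm x ^ 2 =
    4 * (N ^ 2 / (2 * (beta - gamma)) * exp (2 * alpha * t) * norm x ^ 2)).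
  { field; lra. }
  rewrite E1 in H1; rewrite E2 in H2; rewrite E3; lra.
Qed.

End Dichotomy.

Theorem theorem3p8 (F : AbsRing) (hF : F = R_AbsRing \/ F = C_AbsRing)
    (X : CompleteNormedModule F)
    (U : R -> R -> bounded_operator X) (hU : evolution_operator U)
    (P : R -> bounded_operator X) (hP : strong_exponential_dichotomy U P) :
  exists K delta gamma : R,
    1 <= K /\ 0 <= delta /\ 0 < gamma /\
    forall H : R -> bounded_operator X, H_class gamma P H ->
      exists L : R -> X -> R,
        lyapunov_function U H L /\
        forall (t : R) (x : X), 0 <= t ->
          (0 <= L t (P t x) /\ L t (compl P t x) <= 0) /\
          exp (- 2 * gamma * t) * L t (P t x)
            - exp (2 * gamma * t) * L t (compl P t x)
            <= K * exp (2 * delta * t) * (norm x) ^ 2.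

Proof.
  destruct hP as (hproj & hcomp & V & N & alpha & beta & hV & _ & halpha
                  & hbeta & hbounds).
  assert (hstable : forall t s x, 0 <= s <= t ->
     norm (U t s (P s x))
       <= N * exp (alpha * s) * exp (- beta * (t - s)) * norm x).
  { intros t s x Hst.
    apply (op_norm_bound hF (fun x => U t s (P s x)));
      [|exact (proj1 (hbounds t s Hst))].
    intros k y; rewrite (linear_scal _ (op_linear (P s))).
    apply (linear_scal _ (op_linear (U t s))). }
  assert (hunstable : forall t s x, 0 <= s <= t ->
     norm (V s t (compl P t x))
       <= N * exp (alpha * s) * exp (- beta * (t - s)) * norm x).
  { intros t s x Hst.
    apply (op_norm_bound hF (fun x => V s t (compl P t x)));
      [|exact (proj2 (hbounds t s Hst))].
    apply (kernel_inverse_linear U P V hproj hV t s Hst). }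
  assert (hgamma : 0 < beta / 2 < beta) by lra.
  exists (Rmax 1 (2 * N ^ 2 / (beta - beta / 2))), alpha, (beta / 2).
  split; [apply Rmax_l|]; split; [exact halpha|]; split; [lra|].
  intros H hH; exists (lyapunov U P V H); split.
  - eapply (lyapunov_function_lyapunov U P V N alpha beta); eassumption.
  - intros t x Ht; split; [eapply (lyapunov_sign U P V N alpha beta); eassumption|].
    eapply Rle_trans; [eapply (lyapunov_bound U P V N alpha beta); eassumption|].
    apply Rmult_le_compat_r; [apply pow2_ge_0|].
    apply Rmult_le_compat_r; [left; apply exp_pos | apply Rmax_r].
Qed.
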